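(* Let $\kappa > 0$ be a cardinal, and let $G$ and $H$ be topological groups. Then the direct product $G \times H$ (regarded as a topological group in the product topology) is almost $\kappa$-free if and only if at least one of $G$ and $H$ is almost $\kappa$-free.
   Context: Topological groups are not assumed to be Hausdorff. For a cardinal $\kappa>0$ and a group $G$, let $G_\kappa$ denote the set of $\kappa$-tuples $(g_i)_{i\in\kappa}\in G^\kappa$ that freely generate a free subgroup of $G$, i.e. such that no nontrivial reduced group word in the indexed variables $(x_i)_{i\in\kappa}$ evaluates to $1$ at $(g_i)_{i\in\kappa}$ (equivalently, the homomorphism from the free group on $\{x_i\}_{i\in\kappa}$ to $G$ sending $x_i\mapsto g_i$ is injective). An infinite topological group $G$ is called almost $\kappa$-free if $G_\kappa$ is dense in $G^\kappa$ with the product topology (a finite topological group is not almost $\kappa$-free). *)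

(* Defs.v *)
From HB Require Import structures.
From mathcomp Require Import all_boot.
From mathcomp Require Import all_classical.
From mathcomp Require Import topology.

Set Implicit Arguments.
Unset Strict Implicit.
Unset Printing Implicit Defensive.

Local Open Scope classical_set_scope.
Local Open Scope group_scope.

(* Not assumed Hausdorff. *)
HB.mixin Record isTopologicalGroup G of Topological G & Group G := {
  mulg_continuous : continuous (fun x : G * G => x.1 * x.2) ;
  invg_continuous : continuous (fun x : G => x^-1)
}.

#[short(type="topologicalGroupType")]
HB.structure Definition TopologicalGroup :=
  {G of Topological G & Group G & isTopologicalGroup G}.

Lemma continuous_pair (T U V : topologicalType) (f : T -> U) (g : T -> V) :
  continuous f -> continuous g -> continuous (fun x => (f x, g x)).
Proof. by move=> cf cg x; apply: cvg_pair; [exact: cf|exact: cg]. Qed.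

Section ProdTopologicalGroup.
Variables G H : topologicalGroupType.

Lemma pair_mulg_continuous :
  continuous (fun x : (G * H) * (G * H) => x.1 * x.2).
Proof.
have c1 (U V : topologicalType) : continuous (@fst U V).
  by move=> x; exact: cvg_fst.
have c2 (U V : topologicalType) : continuous (@snd U V).
  by move=> x; exact: cvg_snd.
have cc (T U V : topologicalType) (f : T -> U) (g : U -> V) :
    continuous f -> continuous g -> continuous (g \o f).
  by move=> cf cg x; apply: continuous_comp; [exact: cf|exact: cg].
apply: (@continuous_pair _ _ _
    (fun x : (G * H) * (G * H) => x.1.1 * x.2.1)
    (fun x : (G * H) * (G * H) => x.1.2 * x.2.2)).
- apply: (cc _ _ _ (fun x : (G * H) * (G * H) => (x.1.1, x.2.1))
    (fun y : G * G => y.1 * y.2)); last exact: mulg_continuous.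
  apply: continuous_pair.
  + by apply: (cc _ _ _ fst fst); [exact: c1|exact: c1].
  + by apply: (cc _ _ _ snd fst); [exact: c2|exact: c1].
- apply: (cc _ _ _ (fun x : (G * H) * (G * H) => (x.1.2, x.2.2))
    (fun y : H * H => y.1 * y.2)); last exact: mulg_continuous.
  apply: continuous_pair.
  + by apply: (cc _ _ _ fst snd); [exact: c1|exact: c2].
  + by apply: (cc _ _ _ snd snd); [exact: c2|exact: c2].
Qed.

Lemma pair_invg_continuous : continuous (fun x : G * H => x^-1).
Proof.
apply: (@continuous_pair _ _ _
    (fun x : G * H => x.1^-1) (fun x : G * H => x.2^-1)) => x.
- apply: (@continuous_comp _ _ _ fst (fun y : G => y^-1)); first exact: cvg_fst.
  exact: invg_continuous.
- apply: (@continuous_comp _ _ _ snd (fun y : H => y^-1)); first exact: cvg_snd.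
  exact: invg_continuous.
Qed.

HB.instance Definition _ := isTopologicalGroup.Build (G * H)%type
  pair_mulg_continuous pair_invg_continuous.

End ProdTopologicalGroup.

(* Words in the variables x_i (i : K) and their inverses: the letter
   (i, true) is x_i and (i, false) is x_i^-1. *)
Definition reduced_word (K : Type) (w : seq (K * bool)) : Prop :=
  forall (u v : seq (K * bool)) (i : K) (b : bool),
    w <> u ++ [:: (i, b), (i, ~~ b) & v].

Definition eval_word (K : Type) (G : groupType) (g : K -> G)
    (w : seq (K * bool)) : G :=
  \big[*%g/1]_(a <- w) (if a.2 then g a.1 else (g a.1)^-1).

(* The set G_kappa for kappa = |K|, inside G^K with the product topology. *)
Definition free_tuples (K : Type) (G : topologicalGroupType) :
    set {ptws K -> G} :=
  [set g | forall w : seq (K * bool),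
    w <> [::] -> reduced_word w -> eval_word g w <> 1].

Definition almost_free (K : Type) (G : topologicalGroupType) : Prop :=
  infinite_set [set: G] /\ dense (@free_tuples K G).

(* Main.v *)
(* For the forward direction, suppose that open sets U of G^K and V of H^K both
   miss the free tuples.  A free tuple p of G * H whose projections lie in U and
   V satisfies a nontrivial relation in each coordinate.  Two nontrivial normal
   subgroups of a free group meet nontrivially, so some nontrivial word is
   killed in both coordinates, contradicting the freeness of p.  Conversely, a
   tuple of G * H with one free projection is free.  Finite groups need no
   separate treatment, since a free tuple has components of infinite order. *)
Require Import Defs.
From HB Require Import structures.
From mathcomp Require Import all_boot.
From mathcomp Require Import all_classical.
From mathcomp Require Import topology.

Set Implicit Arguments.
Unset Strict Implicit.
Unset Printing Implicit Defensive.

Local Open Scope classical_set_scope.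
Local Open Scope group_scope.

(** * Formal inverses and reduced words *)

Definition inv_letter (K : Type) (a : K * bool) : K * bool := (a.1, ~~ a.2).

Lemma inv_letterK (K : Type) : involutive (@inv_letter K).
Proof. by case=> i b; rewrite /inv_letter/= negbK. Qed.

Definition inv_word (K : Type) (w : seq (K * bool)) : seq (K * bool) :=
  rev (map (@inv_letter K) w).

(** A boolean relation on adjacent letters, so that being reduced becomes [sorted] and the path
    lemmas apply. *)
Definition nocancel (K : Type) : rel (K * bool) :=
  fun a b => `[< b <> inv_letter a >].

Lemma reduced_wordP (K : Type) (w : seq (K * bool)) :
  reduced_word w <-> sorted (@nocancel K) w.
Proof.
split=> [|sw u v i b wE]; last first.
  move: sw; rewrite wE sorted_cat_cons /= => /and3P[_ + _].
  by move=> /asboolP; apply.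
elim: w => // a [//|b w] IHw red /=; apply/andP; split.
  apply/asboolP => bE; apply: (red [::] w a.1 a.2).
  by rewrite bE; case: a {red bE}.
by apply: IHw => u v i c wE; apply: (red (a :: u) v i c); rewrite wE.
Qed.

Lemma nocancel_inv (K : Type) (a b : K * bool) :
  nocancel (inv_letter a) (inv_letter b) = nocancel b a.
Proof.
apply/asboolP/asboolP => nab ab; apply: nab.
- by rewrite -ab inv_letterK.
- by rewrite ab inv_letterK.
Qed.

Lemma sorted_inv_word (K : Type) (w : seq (K * bool)) :
  sorted (@nocancel K) (inv_word w) = sorted (@nocancel K) w.
Proof.
rewrite /inv_word rev_sorted sorted_map.
case: w => //= a w; apply: eq_path => b c; exact: nocancel_inv.
Qed.

Lemma eval_word_cat (K : Type) (G : groupType) (g : K -> G) u v :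
  eval_word g (u ++ v) = eval_word g u * eval_word g v.
Proof. exact: big_cat. Qed.

Lemma eval_word_cons (K : Type) (G : groupType) (g : K -> G) a w :
  eval_word g (a :: w) = eval_word g [:: a] * eval_word g w.
Proof. exact: (eval_word_cat g [:: a]). Qed.

Lemma eval_word_inv_letter (K : Type) (G : groupType) (g : K -> G) a :
  eval_word g [:: inv_letter a] = (eval_word g [:: a])^-1.
Proof. by rewrite /eval_word !big_seq1; case: a => i [] //=; rewrite invgK. Qed.

Lemma eval_word_inv (K : Type) (G : groupType) (g : K -> G) w :
  eval_word g (inv_word w) = (eval_word g w)^-1.
Proof.
elim: w => [|a w IHw]; first by rewrite /eval_word /inv_word !big_nil invg1.
rewrite /inv_word/= rev_cons -cats1 eval_word_cat IHw eval_word_inv_letter.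
by rewrite (eval_word_cons g a w) invgM.
Qed.

Lemma eval_word_nseq (K : Type) (G : groupType) (g : K -> G) n i :
  eval_word g (nseq n (i, true)) = g i ^+ n.
Proof.
elim: n => [|n IHn]; first by rewrite /eval_word big_nil.
by rewrite /= eval_word_cons IHn expgS /eval_word big_seq1.
Qed.

Lemma eval_word_nseq_eq1 (K : Type) (G : groupType) (g : K -> G) n i b :
  eval_word g (nseq n (i, b)) = 1 -> g i ^+ n = 1.
Proof.
case: b; first by rewrite eval_word_nseq.
have -> : nseq n (i, false) = inv_word (nseq n (i, true)).
  by rewrite /inv_word map_nseq rev_nseq.
by rewrite eval_word_inv eval_word_nseq => /(canRL invgK) ->; rewrite invg1.
Qed.

Lemma eval_word_pair (K : Type) (G H : groupType) (p : K -> G * H) w :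
  eval_word p w =
  (eval_word (fun i => (p i).1) w, eval_word (fun i => (p i).2) w).
Proof.
elim: w => [|a w IHw]; first by rewrite /eval_word !big_nil.
rewrite eval_word_cons IHw.
rewrite (eval_word_cons (fun i => (p i).1)) (eval_word_cons (fun i => (p i).2)).
by rewrite /eval_word !big_seq1; case: a.2.
Qed.

Lemma sorted_nseq_nocancel (K : Type) n (a : K * bool) :
  sorted (@nocancel K) (nseq n a).
Proof.
have aa : nocancel a a by apply/asboolP; case: a => i [].
by case: n => //= n; elim: n => //= n ->; rewrite aa.
Qed.

(** With a single generator, the only letter that may follow a given one without cancelling is that
    letter itself, so the sign never changes. *)
Lemma sorted_nseq (K : Type) (i : K) (w : seq (K * bool)) :
  (forall j, j = i) -> sorted (@nocancel K) w ->
  exists b, w = nseq (size w) (i, b).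
Proof.
move=> Ki; case: w => [|[j b] w]; first by exists true.
rewrite (Ki j) {j} /= => wP; exists b; congr (_ :: _).
elim: w b wP => //= -[j c] w IHw b /andP[/asboolP + wP].
rewrite (Ki j) in wP * => ncb.
have cb : c = b by case: b c ncb {wP} => -[].
by rewrite cb in wP *; rewrite {1}(IHw b wP).
Qed.

(** * Conjugation without cancellation *)

Definition conj_word (K : Type) (a : K * bool) (w : seq (K * bool)) :=
  a :: rcons w (inv_letter a).

Lemma eval_conj_word_eq1 (K : Type) (G : groupType) (g : K -> G) a w :
  eval_word g w = 1 -> eval_word g (conj_word a w) = 1.
Proof.
move=> w1; rewrite /conj_word eval_word_cons -cats1 eval_word_cat w1 mul1g.
by rewrite eval_word_inv_letter mulgV.
Qed.

Lemma inv_conj_word (K : Type) (a : K * bool) w :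
  inv_word (conj_word a w) = conj_word a (inv_word w).
Proof.
by rewrite /inv_word /conj_word/= map_rcons rev_cons rev_rcons inv_letterK.
Qed.

(** At the junction the inverse of [a] meets [b], and these cancel only if [a = b]. *)
Lemma sorted_conj_word_cat (K : Type) (a b : K * bool) u v :
  a <> b -> sorted (@nocancel K) (conj_word a u) ->
  sorted (@nocancel K) (conj_word b v) ->
  sorted (@nocancel K) (conj_word a u ++ conj_word b v).
Proof.
move=> ab su sv; rewrite {2}/conj_word sorted_cat_cons; apply/andP; split=> //.
rewrite /conj_word /= !rcons_path last_rcons in su *.
rewrite su /=; apply/asboolP; rewrite inv_letterK => ba; exact: ab.
Qed.

(** Pigeonhole: two generators give four distinct letters, and only three are excluded.
    [{classic _}] supplies the decidable equality used for counting. *)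
Lemma exists_letter (K : Type) (i j : K) (a b c : K * bool) :
  i <> j -> exists d, [/\ d <> a, d <> b & d <> c].
Proof.
move=> ij; apply: contrapT => /forallNP no.
pose s : seq {classic (K * bool)%type} :=
  [:: (i, true); (i, false); (j, true); (j, false)].
have us : uniq s.
  have neq (x y : {classic (K * bool)%type}) : x <> y -> (x == y) = false.
    by move=> /eqP/negbTE.
  by rewrite !cons_uniq !inE !neq // => -[].
pose t : seq {classic (K * bool)%type} := [:: a; b; c].
suff /(uniq_leq_size us) : {subset s <= t} by [].
move=> d _; case: (pselect (d = a)) => [->|da]; first by rewrite inE eqxx.
case: (pselect (d = b)) => [->|db]; first by rewrite !inE eqxx orbT.
case: (pselect (d = c)) => [->|dc]; first by rewrite !inE eqxx !orbT.
by case: (no d).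
Qed.

(** A nonempty middle block keeps the outer blocks apart, so the two junctions can be checked
    separately. *)
Lemma sorted_cat3 (T : Type) (e : rel T) (s1 s2 s3 : seq T) : s2 <> [::] ->
  sorted e (s1 ++ s2) -> sorted e (s2 ++ s3) -> sorted e (s1 ++ s2 ++ s3).
Proof.
case: s2 => // x s2 _; rewrite cat_cons !sorted_cat_cons => /andP[-> _].
by move=> /=.
Qed.

Lemma exists_conj_word (K : Type) (i j : K) (c : K * bool) w :
  i <> j -> w <> [::] -> sorted (@nocancel K) w ->
  exists2 a, a <> c & sorted (@nocancel K) (conj_word a w).
Proof.
move=> ij; case: w => // f w _ sw.
(* Avoiding the inverse of the first letter prevents cancellation on the left, and avoiding the last
   letter prevents it on the right. *)
have [a [af al ac]] := exists_letter (inv_letter f) (last f w) c ij.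
exists a => //=; rewrite rcons_path; apply/and3P; split=> //; apply/asboolP.
- by move=> fa; apply: af; rewrite fa inv_letterK.
- by move=> /(can_inj (@inv_letterK K)).
Qed.

(* In the free group this says that two nontrivial normal subgroups have a
   nontrivial intersection: the witness is the commutator of two conjugates,
   chosen so that no cancellation occurs, or a common power in rank one. *)
Lemma common_relation (K : Type) (w1 w2 : seq (K * bool)) :
  w1 <> [::] -> w2 <> [::] -> reduced_word w1 -> reduced_word w2 ->
  exists w, [/\ w <> [::], reduced_word w &
    forall (G : groupType) (g : K -> G),
      eval_word g w1 = 1 \/ eval_word g w2 = 1 -> eval_word g w = 1].
Proof.
move=> w1N w2N /reduced_wordP s1 /reduced_wordP s2.
case: (pselect (exists i j : K, i <> j)) => [[i [j ij]]|noij].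
(* The letter [(i, true)] to be avoided is arbitrary here; what matters is that [d] then avoids
   [c]. *)
- have [c _ sc] := exists_conj_word (i, true) ij w1N s1.
  have [d dc sd] := exists_conj_word c ij w2N s2.
  have cd : c <> d by move/esym.
  have sc' : sorted (@nocancel K) (conj_word c (inv_word w1)).
    by rewrite -inv_conj_word sorted_inv_word.
  have sd' : sorted (@nocancel K) (conj_word d (inv_word w2)).
    by rewrite -inv_conj_word sorted_inv_word.
  (* The commutator of the two conjugates. Inverting a conjugate keeps its outer letter, so the four
     blocks alternate between [c] and [d] and no junction cancels. *)
  exists ((conj_word c w1 ++ conj_word d w2) ++
          (conj_word c (inv_word w1) ++ conj_word d (inv_word w2))).
  split=> //.
  + apply/reduced_wordP.
    have s12 := sorted_conj_word_cat cd sc sd.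
    have s21 := sorted_conj_word_cat dc sd sc'.
    have s12' := sorted_conj_word_cat cd sc' sd'.
    by rewrite -catA; do 2![apply: sorted_cat3 => //].
  + move=> G g; rewrite !eval_word_cat -!inv_conj_word !eval_word_inv.
    by case=> /eval_conj_word_eq1 ->;
      rewrite ?mul1g ?invg1 ?mulg1 ?mul1g mulgV.
- have Ka (i j : K) : j = i by apply: contrapT => ji; apply: noij; exists j, i.
  have [i] : inhabited K by case: w1 w1N {s1} => // -[].
  have [b1 e1] := sorted_nseq (Ka i) s1; have [b2 e2] := sorted_nseq (Ka i) s2.
  (* Both words are powers of one generator, up to sign; the product of the lengths is a common
     multiple of the exponents. *)
  exists (nseq (size w1 * size w2) (i, true)); split.
  + by case: w1 w1N {s1 e1} => // ? ?; case: w2 w2N {s2 e2}.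
  + by apply/reduced_wordP; exact: sorted_nseq_nocancel.
  + move=> G g; rewrite eval_word_nseq expgnA => -[].
      rewrite {1}e1 => /(@eval_word_nseq_eq1 _ _ _ _ _ _) ->.
      by rewrite expg1n.
    rewrite {1}e2 expgnAC => /(@eval_word_nseq_eq1 _ _ _ _ _ _) ->.
    by rewrite expg1n.
Qed.

(** * Free tuples and the product topology *)

Lemma infinite_of_free (K : Type) (G : topologicalGroupType) (i : K)
    (g : K -> G) : free_tuples g -> infinite_set [set: G].
Proof.
move=> gfree; have gN1 n : g i ^+ n.+1 <> 1.
  rewrite -eval_word_nseq; apply: gfree => //.
  by apply/reduced_wordP; exact: sorted_nseq_nocancel.
(* Two equal powers would make a positive power trivial, so the powers of one component form an
   infinite set. *)
have inj m n : (m < n)%N -> g i ^+ m <> g i ^+ n.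
  move=> mn /esym e; apply: (gN1 (n - m).-1).
  by rewrite prednK ?subn_gt0// expgnFr ?(ltnW mn)// e mulgV.
move=> fG; apply: infinite_nat.
rewrite -(@eq_finite_set _ _ (range (fun n => g i ^+ n))).
  by apply: sub_finite_set fG.
apply: inj_card_eq => m n _ _ e.
by case: (ltngtP m n) => // /inj; [move/(_ e)|move/(_ (esym e))].
Qed.

Lemma ptws_map_continuous (K : Type) (X Y : topologicalType)
    (f : K -> X -> Y) : (forall i, continuous (f i)) ->
  continuous (fun g : {ptws K -> X} => (fun i => f i (g i)) : {ptws K -> Y}).
Proof.
(* The product topology is the supremum of the initial topologies of the projections, so continuity
   is checked one coordinate at a time. *)
move=> cf g; apply/cvg_sup.
  exact: (@fmap_filter _ _ _ _ (@nbhs_filter {ptws K -> X} g)).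
move=> i; move: g.
apply: (@continuous_comp_initial _ _ _ (fun h : K -> Y => h i)) => g.
apply: (@continuous_comp _ _ _ (fun g : {ptws K -> X} => g i) (f i)).
  exact: (@proj_continuous {classic K} (fun=> X) i).
exact: cf.
Qed.

Lemma almost_freeP (K : Type) (G : topologicalGroupType) : inhabited K ->
  almost_free K G <-> dense (@free_tuples K G).
Proof.
move=> [i]; split=> [[]//|dG]; split=> //.
have [|g [_]] := dG setT _ openT; first by exists (fun=> 1).
exact: infinite_of_free.
Qed.

(** Treats both factors of a product at once: [f] is a projection, and [s l x] replaces that
    coordinate of [l] by [x]. Tuples are perturbed only in this coordinate, and any relation
    upstairs is pushed down along [f]. *)
Lemma dense_free_tuples_section (K : Type) (G L : topologicalGroupType)
    (f : L -> G) (s : L -> G -> L) :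
  (forall (l : K -> L) w, eval_word (f \o l) w = f (eval_word l w)) ->
  (forall l, continuous (s l)) ->
  (forall l, s l (f l) = l) -> (forall l x, f (s l x) = x) ->
  dense (@free_tuples K G) -> dense (@free_tuples K L).
Proof.
move=> fM sc sf fs dG O [l Ol] oO.
have /continuousP/(_ O oO) oS := ptws_map_continuous (fun i => sc (l i)).
have [|g [Og gfree]] := dG _ _ oS.
  by exists (f \o l) => /=; under eq_fun do rewrite sf.
exists (fun i => s (l i) (g i)); split=> // w wN sw w1.
apply: (gfree w wN sw); rewrite -[g](_ : f \o (fun i => s (l i) (g i)) = g).
  (* That [f] preserves the identity is read off from its compatibility with the empty word. *)
  rewrite fM w1 -[1](_ : eval_word l [::] = 1); last exact: big_nil.
  by rewrite -fM; exact: big_nil.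
by apply/funext => i /=; rewrite fs.
Qed.

Theorem proposition4 (K : Type) (G H : topologicalGroupType)
    (K_gt0 : inhabited K) :
  almost_free K (G * H)%type <-> almost_free K G \/ almost_free K H.
Proof.
rewrite !almost_freeP//; split=> [dGH|[]]; last 2 first.
- apply: (@dense_free_tuples_section _ _ _ fst (fun l x => (x, l.2))) => //=.
  + by move=> l w; rewrite eval_word_pair.
  + by move=> l x; apply: cvg_pair; [exact: cvg_id|exact: cvg_cst].
  + by case.
- apply: (@dense_free_tuples_section _ _ _ snd (fun l x => (l.1, x))) => //=.
  + by move=> l w; rewrite eval_word_pair.
  + by move=> l x; apply: cvg_pair; [exact: cvg_cst|exact: cvg_id].
  + by case.
apply: contrapT => /not_orP[/denseNE[U [[u [oU Uu]] UF]]].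
move=> /denseNE[V [[v [oV Vv]] VF]].
have oU' := (continuousP _).1 (@ptws_map_continuous K (G * H)%type G
  (fun=> fst)
  (fun _ x => @cvg_fst _ _ (nbhs x.1) (nbhs x.2) (nbhs_filter _))) U oU.
have oV' := (continuousP _).1 (@ptws_map_continuous K (G * H)%type H
  (fun=> snd)
  (fun _ x => @cvg_snd _ _ (nbhs x.1) (nbhs x.2) (nbhs_filter _))) V oV.
have [|p [[Up Vp] pfree]] := dGH _ _ (openI oU' oV').
  (* Pairing points of [U] and [V] shows that the open set of tuples projecting into both is
     nonempty. *)
  by exists (fun i => (u i, v i)).
have nfree (L : topologicalGroupType) (W : set {ptws K -> L})
    (g : {ptws K -> L}) : W `&` @free_tuples K L = set0 -> W g ->
    exists w, [/\ w <> [::], reduced_word w & eval_word g w = 1].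
  move=> WF Wg; apply: contrapT => /forallNP no.
  have : (W `&` @free_tuples K L) g by split=> // w wN sw e; apply: (no w).
  by rewrite WF.
have [w1 [w1N s1 e1]] := nfree _ _ _ UF Up.
have [w2 [w2N s2 e2]] := nfree _ _ _ VF Vp.
have [w [wN sw ew]] := common_relation w1N w2N s1 s2.
by apply: (pfree w wN sw); rewrite eval_word_pair !ew; [|right|left].
Qed.
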